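(* Let $\lambda$ be a non-zero real number and let $r$ be a positive integer. For every integer $n\ge r$, $$\begin{aligned}H_{n,\lambda}(x)&=\sum_{k=0}^{r-1}\frac{1}{k!}\Bigg\{\sum_{j=0}^{k}\sum_{l=0}^{n}\frac{2^{l}\binom{n}{l}\binom{k}{j}}{\binom{l+r-k}{l}}\,S_{2,\lambda}(l+r-k,r-k)\,(-1)^{k-j}H_{n-l,\lambda}(j)\Bigg\}\beta_{k,\lambda}^{(r)}(x)\\&\quad+n!\sum_{k=r}^{n}\Bigg\{\sum_{j=0}^{r}\frac{(-1)^{r-j}\binom{r}{j}2^{k-r}}{k!\,(n-k+r)!}\,H_{n-k+r,\lambda}(j)\Bigg\}\beta_{k,\lambda}^{(r)}(x),\end{aligned}$$ where $H_{n,\lambda}(x)$ are the degenerate Hermite polynomials, $\beta_{k,\lambda}^{(r)}(x)$ are the degenerate Bernoulli polynomials of order $r$, and $S_{2,\lambda}(n,l)$ are the degenerate Stirling numbers of the second kind.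
   Context: Fix a non-zero real number $\lambda$. Put $(x)_{0}=1$, $(x)_n=x(x-1)\cdots(x-n+1)$ for $n\ge1$, and $(x)_{0,\lambda}=1$, $(x)_{n,\lambda}=x(x-\lambda)\cdots(x-(n-1)\lambda)$ for $n\ge 1$. The degenerate exponential functions are $e_\lambda^x(t)=(1+\lambda t)^{x/\lambda}=\sum_{n\ge 0}(x)_{n,\lambda}\frac{t^n}{n!}$, regarded as formal power series in $t$, and $e_\lambda(t)=e_\lambda^1(t)$. The degenerate Hermite polynomials $H_{n,\lambda}(x)$ are defined by $$e_\lambda^{-1}(t^2)\, e_\lambda^{x}(2t)=\sum_{n=0}^\infty H_{n,\lambda}(x)\frac{t^n}{n!}.$$ The degenerate Bernoulli polynomials of order $r$ are defined by $$\bigg(\frac{t}{e_\lambda(t)-1}\bigg)^{r}e_\lambda^x(t)=\sum_{n=0}^\infty \beta_{n,\lambda}^{(r)}(x)\frac{t^n}{n!}.$$ The degenerate Stirling numbers of the second kind $S_{2,\lambda}(n,l)$ are defined by $$(x)_{n,\lambda}=\sum_{l=0}^{n}S_{2,\lambda}(n,l)\,(x)_{l},\qquad n\ge 0.$$ *)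

(* Defs.v *)
From HB Require Import structures.
From mathcomp Require Import all_boot all_order all_algebra.
From mathcomp Require Import boolp reals.

Set Implicit Arguments.
Unset Strict Implicit.
Unset Printing Implicit Defensive.

Import GRing.Theory Num.Theory.
Local Open Scope ring_scope.

(* Formal power series over R: the series \sum_n (coefps f n) t^n. *)
Record fps (R : Type) := Fps { coefps : nat -> R }.

HB.instance Definition _ (R : Type) := gen_eqMixin (fps R).
HB.instance Definition _ (R : Type) := gen_choiceMixin (fps R).

Lemma fpsP (R : Type) (f g : fps R) : coefps f =1 coefps g -> f = g.
Proof. by case: f g => [f] [g] /= /funext ->. Qed.

Section FpsRing.
Variable R : comNzRingType.
Implicit Types f g h : fps R.

Definition fps_zero : fps R := Fps (fun _ => 0).
Definition fps_opp f := Fps (fun n => - coefps f n).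
Definition fps_add f g := Fps (fun n => coefps f n + coefps g n).
Definition fps_one : fps R := Fps (fun n => (n == 0)%:R).
Definition fps_mul f g :=
  Fps (fun n => \sum_(i < n.+1) coefps f i * coefps g (n - i)%N).

Fact fps_addA : associative fps_add.
Proof. by move=> f g h; apply: fpsP => n /=; rewrite addrA. Qed.
Fact fps_addC : commutative fps_add.
Proof. by move=> f g; apply: fpsP => n /=; rewrite addrC. Qed.
Fact fps_add0 : left_id fps_zero fps_add.
Proof. by move=> f; apply: fpsP => n /=; rewrite add0r. Qed.
Fact fps_addN : left_inverse fps_zero fps_opp fps_add.
Proof. by move=> f; apply: fpsP => n /=; rewrite addNr. Qed.

HB.instance Definition _ :=
  GRing.isZmodule.Build (fps R) fps_addA fps_addC fps_add0 fps_addN.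

Let tr n f : {poly R} := \poly_(i < n.+1) coefps f i.

Let trE n f i : (i <= n)%N -> (tr n f)`_i = coefps f i.
Proof. by move=> le_in; rewrite coef_poly ltnS le_in. Qed.

Let tr_mul n f g i :
  (i <= n)%N -> coefps (fps_mul f g) i = (tr n f * tr n g)`_i.
Proof.
move=> le_in; rewrite coefM; apply: eq_bigr => j _.
have le_ji : (j <= i)%N by rewrite -ltnS.
by rewrite !trE // (leq_trans _ le_in) // leq_subr.
Qed.

Fact fps_mulC : commutative fps_mul.
Proof. by move=> f g; apply: fpsP => n; rewrite !(@tr_mul n) // mulrC. Qed.

Fact fps_mulA : associative fps_mul.
Proof.
move=> f g h; apply: fpsP => n.
transitivity ((tr n f * (tr n g * tr n h))`_n).
  rewrite coefM; apply: eq_bigr => i _.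
  by rewrite trE -1?ltnS // (@tr_mul n) // leq_subr.
rewrite mulrA coefM; apply: eq_bigr => i _.
by rewrite trE ?leq_subr // (@tr_mul n) // -ltnS.
Qed.

Fact fps_mul1 : left_id fps_one fps_mul.
Proof.
move=> f; apply: fpsP => n /=.
rewrite big_ord_recl /= mul1r subn0 big1 ?addr0 // => i _.
by rewrite mul0r.
Qed.

Fact fps_mulDl : left_distributive fps_mul fps_add.
Proof.
move=> f g h; apply: fpsP => n /=; rewrite -big_split.
by apply: eq_bigr => i _ /=; rewrite mulrDl.
Qed.

Fact fps_one_neq0 : fps_one != fps_zero.
Proof. by apply/eqP => -[/(congr1 (@^~ 0%N))] /eqP; rewrite oner_eq0. Qed.

HB.instance Definition _ := GRing.Zmodule_isComNzRing.Build (fps R)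
  fps_mulA fps_mulC fps_mul1 fps_mulDl fps_one_neq0.

Definition fpsX : fps R := Fps (fun n => (n == 1)%:R).

(* The composite f(g(t)); meaningful only when g has zero constant term, in
   which case g ^+ k does not contribute to the coefficient of t^n for k > n. *)
Definition fps_comp f g : fps R :=
  Fps (fun n => \sum_(k < n.+1) coefps f k * coefps (g ^+ k) n).

(* The quotient f(t) / t; meaningful only when f has zero constant term. *)
Definition fps_divX f : fps R := Fps (fun n => coefps f n.+1).

Lemma fps_divXK f : coefps f 0 = 0 -> fpsX * fps_divX f = f.
Proof.
move=> f0; apply: fpsP => -[|n] /=; first by rewrite big_ord1 mul0r f0.
rewrite !big_ord_recl /= mul0r add0r mul1r subSS subn0 big1 ?addr0 // => i _.
by rewrite mul0r.
Qed.

End FpsRing.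

Section FpsUnitRing.
Variable R : comUnitRingType.
Implicit Types f g : fps R.

Definition fps_unit : {pred fps R} :=
  [pred f : fps R | coefps f 0 \is a GRing.unit].

(* The first n coefficients of 1 / f. *)
Fixpoint fps_inv_seq f (n : nat) : seq R :=
  if n is m.+1 then
    let s := fps_inv_seq f m in
    rcons s ((coefps f 0)^-1 *
      ((m == 0)%:R - \sum_(i < m) s`_i * coefps f (m - i)%N))
  else [::].

Definition fps_inv f : fps R :=
  if f \in fps_unit then Fps (fun n => (fps_inv_seq f n.+1)`_n) else f.

Let size_inv_seq f n : size (fps_inv_seq f n) = n.
Proof. by elim: n => //= n IHn; rewrite size_rcons IHn. Qed.

Let nth_inv_seq f n i :
  (i < n)%N -> (fps_inv_seq f n)`_i = (fps_inv_seq f i.+1)`_i.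
Proof.
elim: n => // n IHn; rewrite ltnS leq_eqVlt => /predU1P[-> // | lt_in].
by rewrite [fps_inv_seq f n.+1]/= nth_rcons size_inv_seq lt_in IHn.
Qed.

Fact fps_mulVr : {in fps_unit, left_inverse 1 fps_inv *%R}.
Proof.
move=> f Uf; apply: fpsP => n; rewrite /fps_inv Uf /= big_ord_recr /=.
rewrite subnn nth_rcons size_inv_seq ltnn eqxx mulrAC mulVr // mul1r.
under eq_bigr => i _ do
  rewrite -[rcons _ _]/(fps_inv_seq f i.+1) -(@nth_inv_seq f n) //.
by rewrite addrC subrK.
Qed.

Fact fps_unitP f g : g * f = 1 -> f \in fps_unit.
Proof.
move=> /(congr1 (fun h => coefps h 0)) /=; rewrite big_ord1 subnn => gf1.
by apply/unitrPr; exists (coefps g 0); rewrite mulrC.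
Qed.

Fact fps_inv_out : {in [predC fps_unit], fps_inv =1 id}.
Proof. by move=> f; rewrite inE /= /fps_inv => /negbTE->. Qed.

HB.instance Definition _ := GRing.ComNzRing_hasMulInverse.Build (fps R)
  fps_mulVr fps_unitP fps_inv_out.

Lemma fps_unitE f : (f \is a GRing.unit) = (coefps f 0 \is a GRing.unit).
Proof. by []. Qed.

End FpsUnitRing.

Section Degenerate.
Variable R : realType.
Implicit Types (lambda x : R) (n r : nat).

(* (x)_{n,lambda} *)
Definition dffact lambda x n : R := \prod_(i < n) (x - i%:R * lambda).

(* (x)_n; the ssrnat falling factorial only covers natural x. *)
Definition rffact x n : R := \prod_(i < n) (x - i%:R).

(* e_lambda^x(t) = (1 + lambda t)^(x / lambda), expanded in powers of t *)
Definition dexp lambda x : fps R := Fps (fun n => dffact lambda x n / n`!%:R).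

Definition dhermite_gf lambda x : fps R :=
  fps_comp (dexp lambda (-1)) (fpsX R ^+ 2) *
  fps_comp (dexp lambda x) (2%:R * fpsX R).

Definition dhermite lambda n x : R := n`!%:R * coefps (dhermite_gf lambda x) n.

(* t / (e_lambda(t) - 1), as the inverse of the series (e_lambda(t) - 1) / t,
   whose constant term is 1; its defining property is dbernoulli_kernelP. *)
Definition dbernoulli_kernel lambda : fps R := (fps_divX (dexp lambda 1 - 1))^-1.

Lemma dbernoulli_kernelP lambda :
  (dexp lambda 1 - 1) * dbernoulli_kernel lambda = fpsX R.
Proof.
rewrite -[dexp lambda 1 - 1 in LHS]fps_divXK -?mulrA ?mulrV ?mulr1 //.
  by rewrite fps_unitE /= /dffact big_ord1 mul0r !subr0 (factS 0) divr1 unitr1.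
by rewrite /= /dffact big_ord0 fact0 divr1 subrr.
Qed.

Definition dbernoulli_gf lambda r x : fps R :=
  dbernoulli_kernel lambda ^+ r * dexp lambda x.

Definition dbernoulli lambda r n x : R :=
  n`!%:R * coefps (dbernoulli_gf lambda r x) n.

Definition dstirling2_spec lambda (S : nat -> nat -> R) : Prop :=
  forall n x, dffact lambda x n = \sum_(l < n.+1) S n l * rffact x l.

Lemma dstirling2_exists lambda : exists S, dstirling2_spec lambda S.
Proof.
suff ex n : exists s : nat -> R,
    forall x, dffact lambda x n = \sum_(l < n.+1) s l * rffact x l.
  by have [S HS] := choice ex; exists S.
elim: n => [|n [s IHs]].
  by exists (fun=> 1) => x; rewrite big_ord1 /dffact /rffact !big_ord0 mul1r.
pose low l := if (l <= n)%N then s l * (l%:R - n%:R * lambda) else 0.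
pose upp l := if l is k.+1 then s k else 0.
exists (fun l => low l + upp l) => x.
rewrite /dffact big_ord_recr /= -/(dffact lambda x n) IHs mulr_suml.
under [RHS]eq_bigr do rewrite mulrDl.
rewrite big_split /= [X in _ = X + _]big_ord_recr /= [low n.+1]/low ltnn mul0r addr0.
rewrite [X in _ = _ + X]big_ord_recl mul0r add0r -big_split /=.
apply: eq_bigr => i _; rewrite /low -ltnS ltn_ord /rffact.
rewrite [in RHS]big_ord_recr /= [s i * (_ - _) * _]mulrAC.
by rewrite [s i * (_ * _)]mulrA -mulrDr [X in _ = _ * X]addrC addrA subrK mulrAC.
Qed.

(* The values S_{2,lambda}(n, l) are determined by the defining identity for
   l <= n (dstirling2_uniq), and are unspecified for l > n. *)
Definition dstirling2 lambda : nat -> nat -> R :=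
  sval (cid (dstirling2_exists lambda)).

Lemma dstirling2P lambda : dstirling2_spec lambda (dstirling2 lambda).
Proof. exact: svalP. Qed.

Lemma dstirling2_uniq lambda (S : nat -> nat -> R) :
  dstirling2_spec lambda S ->
  forall n l, (l <= n)%N -> S n l = dstirling2 lambda n l.
Proof.
move=> HS n l; elim/ltn_ind: l => l IHl le_ln.
have := HS n l%:R; rewrite (dstirling2P lambda).
have ffact0 k : (l < k)%N -> rffact l%:R k = 0.
  by move=> lt_lk; rewrite /rffact (bigD1 (Ordinal lt_lk)) //= subrr mul0r.
have ffactn0 : rffact l%:R l != 0.
  by apply/prodf_neq0 => i _; rewrite subr_eq0 eqr_nat gtn_eqF.
have lt_ln : (l < n.+1)%N by [].
rewrite (bigD1 (Ordinal lt_ln)) //= [RHS](bigD1 (Ordinal lt_ln)) //= => eq_S.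
suff eq_rest : \sum_(i < n.+1 | i != Ordinal lt_ln)
      dstirling2 lambda n i * rffact l%:R i =
    \sum_(i < n.+1 | i != Ordinal lt_ln) S n i * rffact l%:R i.
  by move: eq_S; rewrite eq_rest => /addIr /(mulIf ffactn0).
apply: eq_bigr => i; rewrite -val_eqE /= neq_ltn => /orP[lt_il | /ffact0->].
  by rewrite IHl // ltnW // (leq_trans lt_il).
by rewrite !mulr0.
Qed.

End Degenerate.

(* Main.v *)
(* Write E^x = e_lambda^x(2t) and F = e_lambda^{-1}(t^2). Substituting 2t in the
   generating function of the Bernoulli polynomials and clearing denominators,
   (2t)^r F E^x = F (E - 1)^r \sum_k beta_k^{(r)}(x) (2t)^k / k!. Since
   E^j = e_lambda^j(2t), the binomial theorem expands F (E - 1)^r in terms of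
   the H_m(j); comparing coefficients of t^(n + r) gives the terms with
   r <= k directly. For k < r one first splits (E - 1)^r as
   (E - 1)^(r - k) (E - 1)^k, where (E - 1)^(r - k) is the generating function
   of the Stirling numbers S_2(-, r - k), up to the factor (r - k)!. *)
Require Import Defs.
From mathcomp Require Import all_boot all_order all_algebra.
From mathcomp Require Import reals.
From mathcomp Require Import zify ring.

Import GRing.Theory Num.Theory.
Local Open Scope ring_scope.

(** * Coefficients of monomials and the substitution of a multiple of t *)

Section FpsCoefficients.
Variable R : comNzRingType.
Implicit Types f g : fps R.

Lemma coefpsM f g n :
  coefps (f * g) n = \sum_(i < n.+1) coefps f i * coefps g (n - i).
Proof. by []. Qed.

Lemma coefps_sum I (s : seq I) (P : pred I) (F : I -> fps R) n :
  coefps (\sum_(i <- s | P i) F i) n = \sum_(i <- s | P i) coefps (F i) n.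
Proof. by apply: (big_morph (fun f : fps R => coefps f n)). Qed.

Lemma coefpsMn f k n : coefps (f *+ k) n = coefps f n *+ k.
Proof. by elim: k => // k IHk; rewrite !mulrS -IHk. Qed.

Lemma coefps_signM k f n : coefps ((-1) ^+ k * f) n = (-1) ^+ k * coefps f n.
Proof. by rewrite -signr_odd -[in RHS]signr_odd; case: odd; rewrite ?mulN1r ?mul1r. Qed.

Lemma coefps_XnM k f n :
  coefps (fpsX R ^+ k * f) n = if (n < k)%N then 0 else coefps f (n - k).
Proof.
elim: k n => [|k IHk] n; first by rewrite expr0 mul1r subn0.
rewrite exprS -mulrA coefpsM; move: (fpsX R ^+ k * f) (IHk n.-1) => g.
case: n => [|n] IHg; first by rewrite big_ord1 mul0r.
rewrite !big_ord_recl /= mul0r add0r mul1r subn1 big1 ?addr0 => [|i _].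
  by rewrite IHg ltnS subSS.
by rewrite mul0r.
Qed.

Lemma coefps_Xn k n : coefps (fpsX R ^+ k) n = (n == k)%:R.
Proof.
rewrite -[_ ^+ k]mulr1 coefps_XnM /= subn_eq0.
by case: ltngtP.
Qed.

(** The substitution f(a t), in a form whose compatibility with products is read off
    coefficientwise. *)
Definition fps_scale (a : R) f : fps R := Fps (fun n => a ^+ n * coefps f n).

Lemma coefps_scale a f n : coefps (fps_scale a f) n = a ^+ n * coefps f n.
Proof. by []. Qed.

Lemma fps_scaleM a f g : fps_scale a (f * g) = fps_scale a f * fps_scale a g.
Proof.
apply: fpsP => n; rewrite /= mulr_sumr; apply: eq_bigr => i _.
have /subnKC {1}<- : (i <= n)%N by rewrite -ltnS.
by rewrite exprD mulrACA.
Qed.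

Lemma fps_scale1 a : fps_scale a 1 = 1.
Proof. by apply: fpsP => -[|n] /=; rewrite ?mulr1 ?mulr0. Qed.

Lemma fps_scaleB a f g : fps_scale a (f - g) = fps_scale a f - fps_scale a g.
Proof. by apply: fpsP => n; rewrite /= mulrBr. Qed.

Lemma fps_scaleXn a f k : fps_scale a (f ^+ k) = fps_scale a f ^+ k.
Proof. by elim: k => [|k IHk]; rewrite ?fps_scale1 // !exprS fps_scaleM IHk. Qed.

Lemma fps_scale_natX a k :
  fps_scale a%:R (fpsX R ^+ k) = fpsX R ^+ k *+ a ^ k.
Proof.
apply: fpsP => n; rewrite coefpsMn coefps_scale coefps_Xn.
by case: eqP => [->|_]; rewrite ?mulr1 ?natrX // mulr0 mul0rn.
Qed.

(** The power (a t)^k is a monomial, so only the last term of the sum defining [fps_comp]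
    survives. *)
Lemma fps_comp_natX f a : fps_comp f (a%:R * fpsX R) = fps_scale a%:R f.
Proof.
have coef_aXk k n : coefps ((a%:R * fpsX R) ^+ k) n = (n == k)%:R *+ (a ^ k).
  by rewrite exprMn -natrX mulr_natl coefpsMn coefps_Xn.
apply: fpsP => n; rewrite /= big_ord_recr big1 => [|k _] /=.
  by rewrite add0r coef_aXk eqxx mulrC natrX.
by rewrite coef_aXk gtn_eqF ?mul0rn ?mulr0 //=.
Qed.

End FpsCoefficients.

Arguments fps_scale {R} a f.

(** * The exponential law for [dexp] *)

Section DegenerateIdentities.
Variables (R : realType) (lambda : R).
Implicit Types (x y : R) (n r k j m : nat).

Local Notation e x := (dexp lambda x).
Local Notation E x := (fps_scale 2%:R (dexp lambda x)).
Local Notation F := (fps_comp (dexp lambda (-1)) (fpsX R ^+ 2)).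

Lemma fact_neq0 n : n`!%:R != 0 :> R.
Proof. by rewrite pnatr_eq0 -lt0n fact_gt0. Qed.

(** The differential equation (1 + lambda t) f' = x f, read at t^n. *)
Lemma coef_dexpS x n :
  n.+1%:R * coefps (e x) n.+1 = (x - n%:R * lambda) * coefps (e x) n.
Proof.
rewrite /= /dffact big_ord_recr /= factS natrM.
have := fact_neq0 n; have : n.+1%:R != 0 :> R by rewrite pnatr_eq0.
by move=> n1_neq0 nf_neq0; field; rewrite nf_neq0 addrC natr1 n1_neq0.
Qed.

(** Both sides have constant term 1 and satisfy the recurrence [coef_dexpS] for x + y. *)
Lemma dexpD x y : e (x + y) = e x * e y.
Proof.
apply: fpsP; elim=> [|n IHn].
  by rewrite coefpsM big_ord1 /= /dffact !big_ord0 fact0 divr1 mulr1.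
have n1_neq0 : n.+1%:R != 0 :> R by rewrite pnatr_eq0.
apply: (mulfI n1_neq0); rewrite coef_dexpS IHn !coefpsM {IHn}.
move: (coefps (e x)) (coefps (e y)) (coef_dexpS x) (coef_dexpS y) => a b aS bS.
(* Leibniz rule: the factor n + 1 is split as i + (n + 1 - i). *)
transitivity (\sum_(i < n.+2) i%:R * a i * b (n.+1 - i)%N
    + \sum_(i < n.+2) a i * ((n.+1 - i)%:R * b (n.+1 - i)%N)); last first.
  rewrite mulr_sumr -big_split; apply: eq_bigr => i _.
  have /natrB-> : (i <= n.+1)%N by rewrite -ltnS.
  by rewrite /=; ring.
(* The end terms i = 0 and i = n + 1 vanish. After a shift of the first sum, the factors given by
   the recurrence add up to (x - i lambda) + (y - (n - i) lambda) = x + y - n lambda. *)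
rewrite [X in _ = X + _]big_ord_recl !mul0r add0r [X in _ = _ + X]big_ord_recr /=.
rewrite subnn mul0r mulr0 addr0 mulr_sumr -big_split; apply: eq_bigr => i _.
have le_in : (i <= n)%N by rewrite -ltnS.
rewrite /bump /= add1n subSS subSn // aS bS natrB //.
by ring.
Qed.

Lemma dexp_nat j : e j%:R = e 1 ^+ j.
Proof.
elim: j => [|j IHj]; last by rewrite exprS -IHj -dexpD nat1r.
apply: fpsP => -[|n] /=; rewrite /dffact ?big_ord0 ?fact0 ?divr1 //.
by rewrite big_ord_recl mul0r subrr !mul0r.
Qed.

(** * Binomial inversion and the generating function of the Stirling numbers *)

Lemma expr_subr1 (A : comNzRingType) (a : A) k :
  (a - 1) ^+ k = \sum_(j < k.+1) (-1) ^+ (k - j) * a ^+ j *+ 'C(k, j).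
Proof.
rewrite addrC exprDn; apply: eq_bigr => j _.
by rewrite mulrC mulrC.
Qed.

Lemma coef_XD1n j l : (('X + 1 : {poly R}) ^+ j)`_l = 'C(j, l)%:R.
Proof.
rewrite exprD1n coef_sum; under eq_bigr do rewrite coefMn coefXn.
have [le_lj | lt_jl] := leqP l j; last first.
  rewrite bin_small // big1 // => i _.
  by rewrite gtn_eqF ?mul0rn // (leq_ltn_trans _ lt_jl) // -ltnS.
have lt_lj1 : (l < j.+1)%N by [].
rewrite (bigD1 (Ordinal lt_lj1)) //= eqxx big1 ?addr0 // => i.
by rewrite -val_eqE eq_sym /= => /negbTE->; rewrite mul0rn.
Qed.

(** Compare coefficients of X^l in X^k = ((X + 1) - 1)^k. *)
Lemma alternating_bin_sum k l :
  \sum_(j < k.+1) (-1) ^+ (k - j) * 'C(k, j)%:R * 'C(j, l)%:R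
  = (k == l)%:R :> R.
Proof.
have -> : (k == l)%:R = (('X + 1 - 1 : {poly R}) ^+ k)`_l.
  by rewrite addrK coefXn eq_sym.
rewrite expr_subr1 coef_sum; apply: eq_bigr => j _.
have -> : (-1 : {poly R}) ^+ (k - j) = ((-1) ^+ (k - j))%:P.
  by rewrite rmorphXn rmorphN1.
by rewrite coefMn coefCM coef_XD1n -[RHS]mulr_natr mulrAC.
Qed.

Lemma rffact_nat j l : rffact j%:R l = l`!%:R * 'C(j, l)%:R :> R.
Proof.
rewrite -natrM mulnC bin_ffact /rffact.
elim: l => [|l IHl]; first by rewrite big_ord0.
rewrite big_ord_recr /= IHl ffactnSr natrM.
have [le_lj | lt_jl] := leqP l j; first by rewrite natrB.
by rewrite ffact_small // !mul0r.
Qed.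

(** The binomial theorem reduces this to the values (j)_{n,lambda}. Expanding them in falling
    factorials and exchanging the sums, [alternating_bin_sum] keeps only l = k, an index in range
    because k <= n. *)
Lemma coef_dexp_sub1X k n : (k <= n)%N ->
  coefps ((e 1 - 1) ^+ k) n = k`!%:R * dstirling2 lambda n k / n`!%:R.
Proof.
move=> le_kn; rewrite expr_subr1 coefps_sum.
under eq_bigr => j _ do
  rewrite coefpsMn -mulr_natl coefps_signM -dexp_nat
          [coefps _ _]/(dffact lambda j%:R n / _) mulrA mulrA dstirling2P.
rewrite -mulr_suml; congr (_ / _).
under eq_bigr do rewrite mulr_sumr.
rewrite exchange_big /=.
transitivity (\sum_(l < n.+1) dstirling2 lambda n l * l`!%:R * (k == l)%:R).
  apply: eq_bigr => l _; rewrite -alternating_bin_sum mulr_sumr.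
  by apply: eq_bigr => j _; rewrite rffact_nat; ring.
have lt_kn1 : (k < n.+1)%N by [].
rewrite (bigD1 (Ordinal lt_kn1)) //= eqxx mulr1 big1 ?addr0 1?mulrC // => l.
by rewrite -val_eqE eq_sym /= => /negbTE->; rewrite mulr0.
Qed.

(** The constant term of e - 1 is 0, so t^k divides its k-th power. *)
Lemma coef_dexp_sub1X_small k n : (n < k)%N -> coefps ((e 1 - 1) ^+ k) n = 0.
Proof.
move=> lt_nk; rewrite -[_ - _]fps_divXK; last first.
  by rewrite /= /dffact big_ord0 fact0 divr1 subrr.
by rewrite exprMn coefps_XnM lt_nk.
Qed.

(** * Differences of Hermite generating functions and their Bernoulli expansion *)

Lemma dhermite_gfE x : dhermite_gf lambda x = F * E x.
Proof. by rewrite /dhermite_gf fps_comp_natX. Qed.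

(** The k-th forward difference in x, taken at x = 0, of the Hermite generating function. *)
Definition dhermite_diff k : fps R := F * (E 1 - 1) ^+ k.

Lemma coef_dhermite_diff k m :
  coefps (dhermite_diff k) m =
  \sum_(j < k.+1) (-1) ^+ (k - j) * 'C(k, j)%:R * dhermite lambda m j%:R / m`!%:R.
Proof.
rewrite /dhermite_diff expr_subr1 mulr_sumr coefps_sum.
apply: eq_bigr => j _; rewrite [F * _]mulrnAr [F * _]mulrCA coefpsMn coefps_signM.
rewrite -fps_scaleXn -dexp_nat -dhermite_gfE /dhermite.
by rewrite -mulr_natl; field; rewrite fact_neq0.
Qed.

Lemma dexp_bernoulli_gf r x :
  (e 1 - 1) ^+ r * dbernoulli_gf lambda r x = fpsX R ^+ r * e x.
Proof. by rewrite /dbernoulli_gf mulrA -exprMn dbernoulli_kernelP. Qed.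

Lemma E_sub1X k : (E 1 - 1) ^+ k = fps_scale 2%:R ((e 1 - 1) ^+ k).
Proof. by rewrite fps_scaleXn fps_scaleB fps_scale1. Qed.

Lemma dhermite_diff_small k m : (m < k)%N -> coefps (dhermite_diff k) m = 0.
Proof.
move=> lt_mk; rewrite coefpsM big1 // => i _.
rewrite E_sub1X /= coef_dexp_sub1X_small ?mulr0 //.
by rewrite (leq_ltn_trans (leq_subr _ _)).
Qed.

Lemma dhermite_bernoulli r n x :
  2%:R ^+ r * dhermite lambda n x =
  n`!%:R * \sum_(k < n.+1)
    2%:R ^+ k / k`!%:R * coefps (dhermite_diff r) (n + r - k) *
    dbernoulli lambda r k x.
Proof.
have eq_gf : fps_scale 2%:R (dbernoulli_gf lambda r x) * dhermite_diff r
    = fps_scale 2%:R (fpsX R ^+ r) * dhermite_gf lambda x.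
  rewrite /dhermite_diff E_sub1X dhermite_gfE mulrCA -fps_scaleM.
  by rewrite [_ * (_ - _) ^+ _]mulrC dexp_bernoulli_gf fps_scaleM mulrCA.
have := congr1 (fun f : fps R => coefps f (n + r)) eq_gf.
rewrite fps_scale_natX mulrnAl coefpsMn coefps_XnM ltnNge leq_addl addnK.
rewrite -[coefps _ _ *+ _]mulr_natl natrX => eq_c.
rewrite /dhermite mulrCA -eq_c; congr (_ * _).
(* The Cauchy product runs up to k = n + r; for k > n the index n + r - k is below r, where
   [dhermite_diff r] has zero coefficients. *)
have le_n_nr : (n.+1 <= (n + r).+1)%N by rewrite ltnS leq_addr.
rewrite coefpsM (big_ord_widen _ (fun k => 2%:R ^+ k / k`!%:R *
  coefps (dhermite_diff r) (n + r - k) * dbernoulli lambda r k x) le_n_nr).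
rewrite [RHS]big_mkcond; apply: eq_bigr => k _.
rewrite ltnS; case: leqP => [_|lt_nk]; last first.
  rewrite dhermite_diff_small ?mulr0 //.
  by have := ltn_ord k; lia.
rewrite coefps_scale /dbernoulli.
by field; rewrite fact_neq0.
Qed.

Lemma dhermite_diff_stirling r k n : (k <= r)%N ->
  coefps (dhermite_diff r) (n + r - k) =
  \sum_(l < n.+1) 2%:R ^+ (l + r - k) * (r - k)`!%:R *
     dstirling2 lambda (l + r - k) (r - k) / (l + r - k)`!%:R *
     coefps (dhermite_diff k) (n - l).
Proof.
move=> le_kr.
have -> : dhermite_diff r = (E 1 - 1) ^+ (r - k) * dhermite_diff k.
  by rewrite /dhermite_diff mulrCA -exprD subnK.
(* The first r - k terms vanish, so the remaining ones are indexed by r - k + l. *)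
rewrite E_sub1X coefpsM -addnBA // -addSn addnC big_split_ord /= big1 ?add0r.
  apply: eq_bigr => l _; have -> : (l + r - k = r - k + l)%N by lia.
  have -> : (n + (r - k) - (r - k + l) = n - l)%N by lia.
  by rewrite coef_dexp_sub1X ?leq_addr // !mulrA.
by move=> i _; rewrite coef_dexp_sub1X_small ?mulr0 ?mul0r.
Qed.

End DegenerateIdentities.

Theorem theorem8 (R : realType) (lambda : R) (lambda_neq0 : lambda != 0)
    (r : nat) (r_gt0 : (0 < r)%N) (n : nat) (le_rn : (r <= n)%N) (x : R) :
  dhermite lambda n x =
    \sum_(0 <= k < r)
       (k`!%:R)^-1 *
       (\sum_(0 <= j < k.+1) \sum_(0 <= l < n.+1)
          (2%:R ^+ l * 'C(n, l)%:R * 'C(k, j)%:R) / 'C(l + r - k, l)%:R *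
          dstirling2 lambda (l + r - k) (r - k) *
          (-1) ^+ (k - j) * dhermite lambda (n - l) j%:R) *
       dbernoulli lambda r k x
  + n`!%:R *
    \sum_(r <= k < n.+1)
       (\sum_(0 <= j < r.+1)
          ((-1) ^+ (r - j) * 'C(r, j)%:R * 2%:R ^+ (k - r)) /
          (k`!%:R * (n - k + r)`!%:R) *
          dhermite lambda (n - k + r) j%:R) *
       dbernoulli lambda r k x.
Proof.
have two_neq0 m : 2%:R ^+ m != 0 :> R by rewrite expf_neq0 ?pnatr_eq0.
(* Multiplying by 2^r gives the left side of [dhermite_bernoulli]; its sum is then cut at k = r. *)
apply: (mulfI (two_neq0 r)); rewrite dhermite_bernoulli [LHS]mulr_sumr.
rewrite -(big_mkord xpredT (fun k => n`!%:R * (2%:R ^+ k / k`!%:R *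
  coefps (dhermite_diff R lambda r) (n + r - k) * dbernoulli lambda r k x))).
rewrite (@big_cat_nat _ _ _ r) //; last exact: leqW.
rewrite mulrDr; congr (_ + _); rewrite ?mulr_sumr; apply: eq_big_nat => k;
    move: (dbernoulli lambda r k x) => b.
  move=> /andP[_ lt_kr]; have le_kr := ltnW lt_kr.
  rewrite dhermite_diff_stirling // !mulrA; congr (_ * _).
  rewrite exchange_big_nat // big_mkord !mulr_sumr; apply: eq_bigr => l _.
  rewrite coef_dhermite_diff big_mkord !mulr_sumr; apply: eq_bigr => j _.
  have le_ln : (l <= n)%N by rewrite -ltnS.
  have le_l : (l <= l + r - k)%N by lia.
  have eq_2 : 2%:R ^+ r * 2%:R ^+ l = 2%:R ^+ k * 2%:R ^+ (l + r - k) :> R.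
    by rewrite -!exprD; congr (_ ^+ _); lia.
  (* Together with [eq_rkl], this turns n! (r - k)! / ((l + r - k)! (n - l)!) into the quotient of
     the two binomials in the statement. *)
  have eq_nl : n`!%:R = 'C(n, l)%:R * (l`!%:R * (n - l)`!%:R) :> R.
    by rewrite -!natrM bin_fact.
  have eq_rkl :
      (l + r - k)`!%:R = 'C(l + r - k, l)%:R * (l`!%:R * (r - k)`!%:R) :> R.
    have -> : (r - k = l + r - k - l)%N by lia.
    by rewrite -!natrM bin_fact.
  have bin_neq0 : 'C(l + r - k, l)%:R != 0 :> R.
    by rewrite pnatr_eq0 -lt0n bin_gt0.
  rewrite eq_nl eq_rkl.
  transitivity (2%:R ^+ k * 2%:R ^+ (l + r - k) / k`!%:R * 'C(n, l)%:R *
    'C(k, j)%:R / 'C(l + r - k, l)%:R * dstirling2 lambda (l + r - k) (r - k) *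
    (-1) ^+ (k - j) * dhermite lambda (n - l) j%:R).
    by field; rewrite !fact_neq0 bin_neq0.
  by rewrite -eq_2; field; rewrite fact_neq0 bin_neq0.
(* For k >= r no Stirling expansion is used: 2^k = 2^(k - r) 2^r, and 2^r cancels. *)
move=> /andP[le_rk lt_kn1]; rewrite -{1}(subnK le_rk) exprD.
have -> : (n + r - k = n - k + r)%N by lia.
rewrite coef_dhermite_diff big_mkord !mulr_sumr !mulr_suml !mulr_sumr.
by apply: eq_bigr => j _; field; rewrite !fact_neq0.
Qed.
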